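(* Let $\mathbb K$ be an algebraically closed field of characteristic zero, let $r\geq 1$ and $N>r$ be integers, and let $V=U\oplus W$ be a $\mathbb K$-vector space with $\dim U=r$ and $\dim W=N-r+1$, so $\mathbb P(V)=\mathbb P^N$, $\mathbb P(U)=\mathbb P^{r-1}$, $\mathbb P(W)=\mathbb P^{N-r}$. Let $Y\subset\mathbb P(W)$ be a non-degenerate irreducible variety whose dual variety $Y^*=V(g)\subset\mathbb P(W^* )$ is a hypersurface, with $g=g(z_0,\ldots,z_{N-r})\in\mathbb K[z_0,\ldots,z_{N-r}]_d$, $d\geq 2$, and let $\widetilde Y\subset\mathbb P(V)$ be the cone with vertex $\mathbb P(U)$ over $Y$. Let $T$ be a vector space of dimension $r+1$ and consider the Segre embedding $\mathbb P(T)\times\widetilde Y\subset\mathbb P(T\otimes V)=\mathbb P^{(r+1)(N+1)-1}$. Identify points of the dual space $\mathbb P(T^*\otimes V^* )$ with $(r+1)\times(N+1)$ matrices $\mathbf X=[A'\,|\,B']$, where $A'=[a_{i,j}]$ ($0\le i\le r$, $0\le j\le N-r$) is $(r+1)\times(N-r+1)$, corresponding to $T^*\otimes W^*$, and $B'$ is $(r+1)\times r$, corresponding to $T^*\otimes U^*$. For $j=0,\ldots,N-r$ let $B'_j$ be the $(r+1)\times(r+1)$ determinant of the matrix whose first column is the $j$-th column of $A'$ followed by the columns of $B'$. Let $f=g(B'_0,\ldots,B'_{N-r})$ and $X=V(f)\subset\mathbb P(T^*\otimes V^* )$. Let $Z_{Y^*}=\overline{\nabla_g(\mathbb P(W^*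 ))}\subseteq\mathbb P(W)$ and let $\mathbb P(T)\times Z_{Y^*}\subset\mathbb P(T\otimes W)\subset\mathbb P(T\otimes V)$ be its Segre embedding. Then: (i) $(\mathbb P(T)\times\widetilde Y)^*=V(g(B'_0,\ldots,B'_{N-r}))\subset\mathbb P(T^*\otimes V^* )$; (ii) $Z_X=\overline{\nabla_f(\mathbb P(T^*\otimes V^* ))}\subseteq S(\mathbb P(T\otimes U),\mathbb P(T)\times Z_{Y^*})\subset\mathbb P(T\otimes V)$, and $X$ has vanishing hessian.
   Context: For a homogeneous polynomial $h$ on a projective space $\mathbb P(E)$, the polar map $\nabla_h:\mathbb P(E)\dashrightarrow\mathbb P(E^* )$ sends a point to the vector of partial derivatives of $h$ evaluated there; the hessian of $h$ is the determinant of its matrix of second partial derivatives, and ''vanishing hessian'' means this determinant is identically zero. For a variety $Z\subset\mathbb P(E)$, $Z^*\subset\mathbb P(E^* )$ is its dual variety (closure of the set of hyperplanes tangent to $Z$ at a smooth point). $S(\Lambda,Z)$ denotes the join (cone) of the linear space $\Lambda=\mathbb P(T\otimes U)$ with the variety $Z$, i.e. the closure of the union of lines joining points of $\Lambda$ and $Z$; here $\mathbb P(T\otimes V)$ is identified with the dual of $\mathbb P(T^*\otimes V^* )$. *)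

(* Defs.v *)
From HB Require Import structures.
From mathcomp Require Import all_boot all_order all_algebra.
From mathcomp Require Import mpoly.
Set Implicit Arguments. Unset Strict Implicit. Unset Printing Implicit Defensive.
Import Order.TTheory GRing.Theory Num.Theory.
Local Open Scope ring_scope.

(* Projective space P(K^n) is handled through affine cones in K^n = 'rV[K]_n:
   a (projective) set_incl is represented by the set of vectors over it
   (together with 0).  Polynomials are elements of {mpoly K[n]}, variable i
   being the i-th coordinate. *)

Section AlgGeom.
Variable K : fieldType.

Definition coords n (x : 'rV[K]_n) : 'I_n -> K := fun i => x 0 i.

Definition ev n (p : {mpoly K[n]}) (x : 'rV[K]_n) : K := meval (coords x) p.

Definition zero_locus n (S : {mpoly K[n]} -> Prop) : 'rV[K]_n -> Prop :=
  fun x => forall p, S p -> ev p x = 0.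

Definition zero_set n (g : {mpoly K[n]}) : 'rV[K]_n -> Prop :=
  fun x => ev g x = 0.

Definition ideal_of n (A : 'rV[K]_n -> Prop) : {mpoly K[n]} -> Prop :=
  fun p => forall a, A a -> ev p a = 0.

Definition zclosure n (A : 'rV[K]_n -> Prop) : 'rV[K]_n -> Prop :=
  zero_locus (ideal_of A).

Definition set_incl n (A B : 'rV[K]_n -> Prop) := forall x, A x -> B x.

Definition proj_closed n (C : 'rV[K]_n -> Prop) : Prop :=
  exists S : {mpoly K[n]} -> Prop,
    (forall p, S p -> exists d, p \is d.-homog) /\
    (forall x, C x <-> zero_locus S x).

Definition proj_variety n (C : 'rV[K]_n -> Prop) : Prop :=
  proj_closed C /\ (exists x, C x /\ x != 0) /\
  forall C1 C2, proj_closed C1 -> proj_closed C2 ->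
    set_incl C (fun x => C1 x \/ C2 x) -> set_incl C C1 \/ set_incl C C2.

Definition nondegenerate_var n (C : 'rV[K]_n -> Prop) : Prop :=
  forall h : 'rV[K]_n, (forall x, C x -> x *m h^T = 0) -> h = 0.

Definition grad n (p : {mpoly K[n]}) (x : 'rV[K]_n) : 'rV[K]_n :=
  \row_i ev (mderiv i p) x.

Definition jac_rank_ge n (A : 'rV[K]_n -> Prop) (x : 'rV[K]_n) (k : nat) :=
  exists ps : k.-tuple {mpoly K[n]},
    (forall i, ideal_of A (tnth ps i)) /\
    \rank (\matrix_(i < k) grad (tnth ps i) x) = k.

(* smooth point (Jacobian criterion): a nonzero point of A at which the
   rank of the Jacobian of I(A) attains its maximum on A *)
Definition smooth_pt n (A : 'rV[K]_n -> Prop) (x : 'rV[K]_n) :=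
  A x /\ x != 0 /\ forall y k, A y -> jac_rank_ge A y k -> jac_rank_ge A x k.

(* the hyperplane h (a vector of the dual space) contains the embedded
   tangent space of A at x, i.e. h lies in the row space of the Jacobian
   of I(A) at x, which is {grad p x | p in I(A)} *)
Definition tangent_hyp n (A : 'rV[K]_n -> Prop) (x h : 'rV[K]_n) :=
  exists p, ideal_of A p /\ h = grad p x.

(* dual variety: zclosure of the hyperplanes tangent at a smooth point;
   dual coordinates w.r.t. the dual basis *)
Definition dual_variety n (A : 'rV[K]_n -> Prop) : 'rV[K]_n -> Prop :=
  zclosure (fun h => h != 0 /\ exists x, smooth_pt A x /\ tangent_hyp A x h).

Definition polar_image n (h : {mpoly K[n]}) : 'rV[K]_n -> Prop :=
  zclosure (fun y => exists x, y = grad h x).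

Definition join_var n (A B : 'rV[K]_n -> Prop) : 'rV[K]_n -> Prop :=
  zclosure (fun z => exists a b, A a /\ B b /\ z = a + b).

Definition hessian_poly n (h : {mpoly K[n]}) : {mpoly K[n]} :=
  \det (\matrix_(i < n, j < n) mderiv j (mderiv i h)).

(* ---- the specific setting: T (dim r+1), W (dim w), U (dim r);
   V = W (+) U; T (x) V = (r+1) x (w+r) matrices, flattened by mxvec.  The
   same coordinates are used for T (x) V and its dual T^* (x) V^* (entrywise
   pairing); W-columns come first, then U-columns, matching X = [A' | B']. *)

Definition mxset m c (P : 'M[K]_(m, c) -> Prop) : 'rV[K]_(m * c) -> Prop :=
  fun x => P (vec_mx x).

Definition cone_over w r (Y : 'rV[K]_w -> Prop) : 'rV[K]_(w + r) -> Prop :=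
  fun v => Y (lsubmx v).

Definition segre m c (Z : 'rV[K]_c -> Prop) : 'rV[K]_(m * c) -> Prop :=
  mxset (fun M => exists (t : 'cV[K]_m) (v : 'rV[K]_c), Z v /\ M = t *m v).

Definition PTU m w r : 'rV[K]_(m * (w + r)) -> Prop :=
  mxset (fun M : 'M[K]_(m, w + r) => lsubmx M = 0).

Definition segreW m w r (Z : 'rV[K]_w -> Prop) : 'rV[K]_(m * (w + r)) -> Prop :=
  @segre m _ (fun v : 'rV[K]_(w + r) => Z (lsubmx v) /\ rsubmx v = 0).

Definition Xvar r w (i : 'I_r.+1) (j : 'I_(w + r)) : {mpoly K[r.+1 * (w + r)]} :=
  'X_(mxvec_index i j).

Definition Bdet r w (j : 'I_w) : {mpoly K[r.+1 * (w + r)]} :=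
  \det (\matrix_(a < r.+1, b < r.+1)
          match unlift ord0 b with
          | None => Xvar a (lshift r j)
          | Some k => Xvar a (rshift w k)
          end).

Definition fpoly r w (g : {mpoly K[w]}) : {mpoly K[r.+1 * (w + r)]} :=
  comp_mpoly [tuple Bdet r j | j < w] g.

End AlgGeom.

Arguments segre {K} m {c} Z.
Arguments PTU {K} m w r.
Arguments segreW {K} m {w} r Z.
Arguments cone_over {K} {w} r Y.
Arguments fpoly {K} r {w} g.
Arguments Bdet {K} r {w} j.

(* Main.v *)
Require Import Defs.
From HB Require Import structures.
From mathcomp Require Import all_boot all_order all_algebra.
From mathcomp Require Import mpoly.
From Stdlib Require Import Classical_Prop.
Import GRing.Theory.
Local Open Scope ring_scope.
Set Implicit Arguments.
Unset Strict Implicit.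
Unset Printing Implicit Defensive.

(* A hyperplane X = [A' | B'] is tangent to P(T) x (cone over Y) at t (x) v,
   v = (y, u), iff X v = 0, t B' = 0 and t A' is conormal to Y at y.  When B' has
   rank r, its left kernel is spanned by the vector of maximal minors of B', so
   t A' is proportional to (B'_j)_j and tangency means that (B'_j)_j lies on Y^*,
   i.e. g(B'_0, ...) = 0; matrices with rank B' < r are limits of such X inside
   V(f).  The T (x) W part of grad f is (minors of B') (x) grad g, of rank one:
   this gives the inclusion in the join, and a vanishing 2x2 minor is an algebraic
   relation between the partial derivatives of f, whence the zero hessian. *)

(** * Polynomial calculus along lines and affine maps *)

Section Calculus.
Variable K : closedFieldType.

Lemma evD n (p q : {mpoly K[n]}) x : ev (p + q) x = ev p x + ev q x.
Proof. by rewrite /ev mevalD. Qed.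

Lemma evB n (p q : {mpoly K[n]}) x : ev (p - q) x = ev p x - ev q x.
Proof. by rewrite /ev mevalB. Qed.

Lemma evM n (p q : {mpoly K[n]}) x : ev (p * q) x = ev p x * ev q x.
Proof. by rewrite /ev mevalM. Qed.

Lemma evZ n c (p : {mpoly K[n]}) x : ev (c *: p) x = c * ev p x.
Proof. by rewrite /ev mevalZ. Qed.

Lemma ev_sum n I (s : seq I) (F : I -> {mpoly K[n]}) x :
  ev (\sum_(i <- s) F i) x = \sum_(i <- s) ev (F i) x.
Proof. by rewrite /ev raddf_sum. Qed.

Lemma poly_eq0_of_roots (p : {poly K}) : (forall s, p.[s] = 0) -> p = 0.
Proof.
move=> p0; apply/eqP; case: eqP => // /eqP /closed_nonrootP [x].
by rewrite rootE p0 eqxx.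
Qed.

Lemma mpoly_ring_ind n (P : {mpoly K[n]} -> Prop) :
  (forall c, P c%:MP) -> (forall i, P 'X_i) ->
  (forall p q, P p -> P q -> P (p + q)) ->
  (forall p q, P p -> P q -> P (p * q)) -> forall p, P p.
Proof.
move=> PC PX PD PM; elim/mpolyind => [|c m p _ _ Pp].
  by rewrite -mpolyC0; apply: (PC).
apply: PD => //; rewrite -mul_mpolyC; apply: (PM); first exact: PC.
rewrite mpolyXE_id; apply: big_ind => [||i _]; [by rewrite -mpolyC1; apply: (PC)|exact: PM|].
by elim: (m i) => [|k IH]; rewrite ?expr0 -?mpolyC1 // exprS; apply: (PM).
Qed.

(** A single univariate [phi] carries both the values on the line and the directional derivative, so
    both properties pass through sums and products. *)
Lemma ev_on_line n (p : {mpoly K[n]}) (x h : 'rV[K]_n) :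
  exists2 phi : {poly K}, forall s, phi.[s] = ev p (x + s *: h)
    & phi^`().[0] = (grad p x *m h^T) 0 0.
Proof.
elim/mpoly_ring_ind: p => [c|i|p q [f fE f'E] [g gE g'E]|p q [f fE f'E] [g gE g'E]].
- exists c%:P => [s|]; first by rewrite hornerC /ev mevalC.
  rewrite derivC horner0 mxE big1 // => i _.
  by rewrite !mxE mderivC /ev meval0 mul0r.
- exists ((x 0 i)%:P + h 0 i *: 'X) => [s|].
    by rewrite !hornerE /ev mevalXU /coords !mxE mulrC.
  rewrite derivD derivC add0r derivZ derivX hornerZ hornerC mulr1.
  rewrite mxE (bigD1 i) //= !mxE mderivX /ev mnm1E eqxx scale1r.
  have -> : (U_(i) - U_(i))%MM = 0%MM by apply/mnmP => k; rewrite mnmBE subnn mnm0E.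
  rewrite mpolyX0 meval1 mul1r big1 ?addr0 // => j ji.
  by rewrite !mxE mderivX mnm1E eq_sym (negPf ji) evZ !mul0r.
- exists (f + g) => [s|]; first by rewrite hornerD fE gE evD.
  rewrite derivD hornerD f'E g'E -[RHS]addr0 !mxE -big_split /= addr0.
  by apply: eq_bigr => i _; rewrite !mxE mderivD evD mulrDl.
- exists (f * g) => [s|]; first by rewrite hornerM fE gE evM.
  rewrite derivM !hornerE f'E g'E fE gE !scale0r !addr0.
  rewrite !mxE mulr_suml mulr_sumr -big_split /=.
  by apply: eq_bigr => i _; rewrite !mxE mderivM evD !evM mulrDl mulrAC mulrA.
Qed.

(** The field is infinite, so the values on the line determine [phi]; a gradient can be computed
    from any such polynomial. *)
Lemma grad_on_line n (p : {mpoly K[n]}) (x h : 'rV[K]_n) (phi : {poly K}) :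
  (forall s, ev p (x + s *: h) = phi.[s]) ->
  phi^`().[0] = (grad p x *m h^T) 0 0.
Proof.
move=> phiE; have [f fE <-] := ev_on_line p x h.
suff /eqP : f - phi = 0 by rewrite subr_eq0 => /eqP ->.
by apply: poly_eq0_of_roots => s; rewrite !hornerE fE phiE subrr.
Qed.

Lemma eq_pairing n (u v : 'rV[K]_n) :
  (forall h : 'rV[K]_n, (u *m h^T) 0 0 = (v *m h^T) 0 0) -> u = v.
Proof.
move=> uv; apply/rowP => i; have := uv (delta_mx 0 i).
by rewrite trmx_delta -!colE !mxE.
Qed.

Lemma gradB n (p q : {mpoly K[n]}) x : grad (p - q) x = grad p x - grad q x.
Proof. by apply/rowP => i; rewrite !mxE mderivB evB. Qed.

Lemma gradD n (p q : {mpoly K[n]}) x : grad (p + q) x = grad p x + grad q x.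
Proof. by apply/rowP => i; rewrite !mxE mderivD evD. Qed.

Lemma gradZ n c (p : {mpoly K[n]}) x : grad (c *: p) x = c *: grad p x.
Proof. by apply/rowP => i; rewrite !mxE mderivZ evZ. Qed.

Lemma gradM n (p q : {mpoly K[n]}) x :
  grad (p * q) x = ev q x *: grad p x + ev p x *: grad q x.
Proof.
by apply/rowP => i; rewrite !mxE mderivM evD !evM; congr (_ + _); rewrite mulrC.
Qed.

Lemma grad_sum n I (s : seq I) (F : I -> {mpoly K[n]}) x :
  grad (\sum_(i <- s) F i) x = \sum_(i <- s) grad (F i) x.
Proof.
apply/rowP => i; rewrite summxE mxE raddf_sum ev_sum.
by apply: eq_bigr => j _; rewrite mxE.
Qed.

Definition linform n (h : 'rV[K]_n) : {mpoly K[n]} := \sum_i h 0 i *: 'X_i.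

Lemma ev_linform n (h x : 'rV[K]_n) : ev (linform h) x = (x *m h^T) 0 0.
Proof.
rewrite ev_sum mxE; apply: eq_bigr => i _.
by rewrite evZ /ev mevalXU mxE mulrC.
Qed.

Lemma grad_linform n (h x : 'rV[K]_n) : grad (linform h) x = h.
Proof.
apply: eq_pairing => k.
rewrite -(@grad_on_line _ _ _ _ (((x *m h^T) 0 0)%:P + (k *m h^T) 0 0 *: 'X)).
  rewrite derivD derivC derivZ derivX !hornerE.
  by rewrite -[h in RHS]trmxK -trmx_mul [RHS]mxE.
by move=> s; rewrite ev_linform mulmxDl -scalemxAl !hornerE !mxE [s * _]mulrC.
Qed.

(** Lines go to lines under an affine map, which gives the chain rule. It transfers equations, and
    their gradients with them, between [Y] and the Segre variety. *)
Lemma affine_pullback k n (p : {mpoly K[n]}) (a : 'rV[K]_n) (C : 'M[K]_(k, n)) :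
  exists2 q : {mpoly K[k]}, forall z, ev q z = ev p (a + z *m C)
    & forall z, grad q z = grad p (a + z *m C) *m C^T.
Proof.
pose q := comp_mpoly [tuple (a 0 j)%:MP + linform (col j C)^T | j < n] p.
have qE z : ev q z = ev p (a + z *m C).
  rewrite /ev comp_mpoly_meval; apply: meval_eq => j.
  rewrite tnth_mktuple mevalD mevalC -/(ev _ z) ev_linform trmxK.
  by rewrite colE mulmxA -colE /coords !mxE.
exists q => // z; apply: eq_pairing => h.
have [phi phiE phi'E] := ev_on_line p (a + z *m C) (h *m C).
rewrite -mulmxA -trmx_mul -phi'E; symmetry; apply: grad_on_line => s.
by rewrite qE phiE mulmxDl addrA scalemxAl.
Qed.

Lemma ev_homogZ n d (p : {mpoly K[n]}) c x :
  p \is d.-homog -> ev p (c *: x) = c ^+ d * ev p x.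
Proof.
move=> /dhomogP hp; rewrite /ev !mevalE mulr_sumr big_seq [RHS]big_seq.
apply: eq_bigr => m /hp md; rewrite mulrCA; congr (_ * _).
rewrite -md /= mdegE -prodrXr -big_split /=; apply: eq_bigr => i _.
by rewrite /coords mxE exprMn.
Qed.

(** In characteristic zero a nonzero coefficient of positive degree survives in some partial
    derivative, which again vanishes everywhere; induction on the degree leads to the constant term,
    the value at 0. *)
Lemma mpoly_eq0_of_ev n (p : {mpoly K[n]}) :
  [pchar K] =i pred0 -> (forall x, ev p x = 0) -> p = 0.
Proof.
move=> /pcharf0P K0 p0; apply/mpolyP => m; rewrite mcoeff0.
move: {2}(mdeg m) (erefl (mdeg m)) => k; elim: k m p p0 => [|k IH] m p p0 mk.
  have -> : m = 0%MM by apply/eqP; rewrite -mdeg_eq0 mk.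
  have := p0 0; rewrite /ev mevalE; have [mp|/memN_msupp_eq0 //] := boolP (0%MM \in msupp p).
  rewrite (bigD1_seq 0%MM) ?msupp_uniq //= big1 ?mulr1 => [|i _]; last by rewrite mnm0E expr0.
  rewrite big1 ?addr0 // => m' m'0; apply/eqP; rewrite mulf_eq0; apply/orP; right.
  have /existsP [i mi] : [exists i, m' i != 0%N].
    apply: contraR m'0; rewrite negb_exists => /forallP m0.
    by apply/eqP/mnmP => i; rewrite mnm0E; apply/eqP; rewrite -[_ == _]negbK.
  by rewrite (bigD1 i) //= /coords mxE expr0n (negPf mi) mul0r.
have /existsP [i mi] : [exists i, m i != 0%N].
  apply/negbNE/negP => /existsPn m0.
  by move: mk; rewrite mdegE big1 // => i _; apply/eqP; rewrite -[_ == _]negbK.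
have mE : m = (m - U_(i) + U_(i))%MM by rewrite submK // lep1mP.
have dp0 x : ev (mderiv i p) x = 0.
  have [phi phiE] := ev_on_line p x (delta_mx 0 i).
  rewrite (poly_eq0_of_roots (p := phi)) => [|s]; last by rewrite phiE p0.
  by rewrite deriv0 horner0 trmx_delta -colE !mxE => <-.
have := IH (m - U_(i))%MM _ dp0; rewrite mcoeff_deriv -mE => /(_ _)/eqP.
rewrite -mulr_natr mulf_eq0 K0 orbF => pm; apply/eqP/pm.
by move: mk; rewrite {1}mE mdegD mdeg1 addn1 => -[].
Qed.

End Calculus.

(** * Conormal spaces and smooth points of cones *)

Section Conormal.
Variable K : closedFieldType.

Lemma trmx11 (M : 'M[K]_1) : M^T = M.
Proof. by rewrite [M]mx11_scalar tr_scalar_mx. Qed.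

Lemma trmx_eq0 m n (M : 'M[K]_(m, n)) : (M^T == 0) = (M == 0).
Proof. by rewrite -(inj_eq trmx_inj) trmxK trmx0. Qed.

(** Adjoining to the row space a vector of [L] outside it raises the rank, which is bounded by [n];
    [k] bounds the number of steps left. *)
Lemma subspace_mx n (L : 'rV[K]_n -> Prop) :
  L 0 -> (forall a u v, L u -> L v -> L (a *: u + v)) ->
  exists G : 'M[K]_n, forall u, L u <-> (u <= G)%MS.
Proof.
move=> L0 Llin.
have main k (G : 'M[K]_n) : (forall u, (u <= G)%MS -> L u) -> (n <= \rank G + k)%N ->
    exists G : 'M[K]_n, forall u, L u <-> (u <= G)%MS.
  elim: k G => [|k IH] G GL rG.
    exists G => u; split=> [_|/GL //]; apply: submx_full.
    by rewrite /row_full eqn_leq rank_leq_col -[\rank G]addn0.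
  case: (classic (exists2 u, L u & ~~ (u <= G)%MS)) => [[u Lu uG]|max]; last first.
    exists G => u; split=> [Lu|/GL //]; apply/negP => uG.
    by apply: max; exists u => //; apply/negP.
  apply: (IH (G + u)%MS) => [w /sub_addsmxP [[a b] /= ->]|].
    rewrite addrC [b]mx11_scalar mul_scalar_mx; apply: Llin => //.
    by apply: GL; rewrite submxMl.
  apply: leq_trans rG _; rewrite addnS -addSn leq_add2r.
  apply: rank_ltmx; rewrite /ltmx addsmxSl /=.
  by apply: contra uG => /(submx_trans _); apply; rewrite addsmxSr.
apply: (main n 0) => [u|]; last by rewrite leq_addl.
by rewrite submx0 => /eqP ->.
Qed.

Lemma conormal_mx n (A : 'rV[K]_n -> Prop) x :
  exists G : 'M[K]_n, forall h, tangent_hyp A x h <-> (h <= G)%MS.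
Proof.
apply: subspace_mx => [|a u v [p [Ap ->]] [q [Aq ->]]].
  by exists (0 *: 0); split=> [b _|]; rewrite ?evZ ?mul0r // gradZ scale0r.
exists (a *: p + q); rewrite gradD gradZ; split=> // b Ab.
by rewrite evD evZ Ap // Aq // mulr0 addr0.
Qed.

(** The largest Jacobian rank at [x] is the dimension of the conormal space, so smoothness becomes a
    comparison of ranks. *)
Lemma jac_rank_geE n (A : 'rV[K]_n -> Prop) x k (G : 'M[K]_n) :
  (forall h, tangent_hyp A x h <-> (h <= G)%MS) ->
  jac_rank_ge A x k <-> (k <= \rank G)%N.
Proof.
move=> GE; split=> [[ps [psA <-]]|kG].
  apply/mxrankS/row_subP => i; apply/GE; exists (tnth ps i).
  by rewrite rowK.
(* The first [k] vectors of a basis of the conormal space; each is the gradient of some equation. *)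
pose J := pid_mx k *m row_base G : 'M_(k, n).
have /fin_all_exists [p pE] i : exists p, ideal_of A p /\ row i J = grad p x.
  by apply/GE; rewrite row_mul (submx_trans (submxMl _ _)) ?eq_row_base.
exists [tuple p i | i < k]; split=> [i|]; first by rewrite tnth_mktuple; case: (pE i).
have -> : \matrix_i grad (tnth [tuple p i | i < k] i) x = J.
  by apply/row_matrixP => i; rewrite rowK tnth_mktuple; case: (pE i).
by rewrite mxrankMfree ?row_base_free // rank_pid_mx.
Qed.

Lemma tangent_line n (A : 'rV[K]_n -> Prop) x h k :
  tangent_hyp A x h -> (forall s, A (x + s *: k)) -> (h *m k^T) 0 0 = 0.
Proof.
move=> [p [Ap ->]] Al; rewrite -(@grad_on_line _ _ _ _ _ 0) ?deriv0 ?horner0 // => s.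
by rewrite Ap ?horner0.
Qed.

Lemma row_dual n (u : 'rV[K]_n) : u != 0 -> exists e : 'rV[K]_n, u *m e^T = 1%:M.
Proof.
case/rV0Pn => i ui; exists ((u 0 i)^-1 *: delta_mx 0 i).
rewrite linearZ /= trmx_delta -scalemxAr -colE [LHS]mx11_scalar !mxE mulVf //.
Qed.

Lemma unitmx_transport n (u v : 'rV[K]_n) :
  u != 0 -> v != 0 -> exists2 P : 'M[K]_n, P \in unitmx & u *m P = v.
Proof.
move=> u0 v0; have [e ue] := row_dual u0.
have uv : u *m (e^T *m v) = v by rewrite mulmxA ue mul1mx.
have [|P Pu uP] := @complete_unitmx _ _ _ u (e^T *m v); first by rewrite uv !rank_rV u0 v0.
by exists P; rewrite // -uP.
Qed.

Section Cone.
Variables (n : nat) (A : 'rV[K]_n -> Prop).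
Hypothesis A_cone : forall a y, A y -> A (a *: y).

Lemma conormal_orth x h : A x -> tangent_hyp A x h -> h *m x^T = 0.
Proof.
move=> Ax th; rewrite [LHS]mx11_scalar (tangent_line th) ?raddf0 // => s.
by rewrite -[x in x + _]scale1r -scalerDl; apply: A_cone.
Qed.

(** Each line through 0 and a point of the cone lies in the cone, so a conormal vector at 0
    annihilates all of [A]. For a non-degenerate cone it is therefore 0. *)
Lemma conormal0 h : tangent_hyp A 0 h -> forall x, A x -> x *m h^T = 0.
Proof.
move=> th x Ax; apply: trmx_inj; rewrite trmx_mul trmxK trmx0 [LHS]mx11_scalar.
by rewrite (tangent_line th) ?raddf0 // => s; rewrite add0r; apply: A_cone.
Qed.

End Cone.

(** * Conormal spaces and smooth points of the Segre product with a cone *)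

Section Segre.
Variables (m w r : nat) (Y : 'rV[K]_w -> Prop).
Hypothesis Y_cone : forall a y, Y y -> Y (a *: y).
Local Notation S := (segre m (cone_over r Y)).

Lemma segre_mxvec (t : 'cV[K]_m) (v : 'rV[K]_(w + r)) :
  Y (lsubmx v) -> S (mxvec (t *m v)).
Proof. by move=> Yv; rewrite /segre /mxset mxvecK; exists t, v. Qed.

Lemma segre_cone a x : S x -> S (a *: x).
Proof.
move=> [t [v [Yv xE]]]; rewrite -(vec_mxK x) xE -linearZ /= scalemxAl.
exact: segre_mxvec.
Qed.

Lemma mxvec_pairing c (X H : 'M[K]_(m, c)) u v :
  H = u^T *m v -> mxvec X *m (mxvec H)^T = u *m X *m v^T.
Proof.
move=> ->; apply: trmx_inj; rewrite trmx_mul trmxK mxvec_dotmul.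
by rewrite trmx11.
Qed.

(** The variety contains the lines through [t *m v] in the directions [t' *m v] and
    [t *m row_mx 0 u]; these give [X *m v^T = 0] and the zero block. Restricting an equation to
    [y |-> t *m row_mx y (rsubmx v)] yields one of [Y] with gradient [nu]. *)
Lemma segre_conormal_sub (t : 'cV[K]_m) (v : 'rV[K]_(w + r)) (X : 'M[K]_(m, w + r)) :
  Y (lsubmx v) -> tangent_hyp S (mxvec (t *m v)) (mxvec X) ->
  X *m v^T = 0 /\
  exists2 nu, tangent_hyp Y (lsubmx v) nu & t^T *m X = row_mx nu 0.
Proof.
move=> Yv tX; split.
  apply/colP => i; rewrite [RHS]mxE.
  have := @tangent_line _ _ _ _ (mxvec ((delta_mx 0 i)^T *m v)) tX.
  rewrite (mxvec_pairing _ erefl) -mulmxA -rowE mxE; apply=> s.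
  by rewrite -linearZ -linearD /= scalemxAl -mulmxDl; apply: segre_mxvec.
have tangent_t z : (forall s, Y (lsubmx (v + s *: z))) -> t^T *m X *m z^T = 0.
  move=> Yz; rewrite [LHS]mx11_scalar -(mxvec_pairing _ (H := t *m z)) ?trmxK //.
  rewrite (tangent_line tX) ?raddf0 // => s.
  by rewrite -linearZ -linearD /= scalemxAr -mulmxDr; apply: segre_mxvec.
exists (lsubmx (t^T *m X)); last first.
  rewrite -{1}[t^T *m X]hsubmxK; congr row_mx; apply: eq_pairing => k.
  have := tangent_t (row_mx 0 k); rewrite -{1}[t^T *m X]hsubmxK tr_row_mx mul_row_col.
  rewrite trmx0 mulmx0 add0r mul0mx => -> // s.
  by rewrite linearD linearZ /= row_mxKl scaler0 addr0.
case: tX => p [pS gp].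
pose C := row_mx 1%:M 0 *m lin1_mx (mxvec \o mulmx t) : 'M[K]_(w, m * (w + r)).
have CE y : y *m C = mxvec (t *m row_mx y 0).
  by rewrite mulmxA mul_rV_lin1 /= mul_mx_row mulmx1 mulmx0.
have [q qE gq] := affine_pullback p (mxvec (t *m row_mx 0 (rsubmx v))) C.
have aE y : mxvec (t *m row_mx 0 (rsubmx v)) + y *m C = mxvec (t *m row_mx y (rsubmx v)).
  by rewrite CE -linearD -mulmxDr add_row_mx addr0 add0r.
exists q; split=> [y Yy|].
  by rewrite qE aE pS //; apply: segre_mxvec; rewrite row_mxKl.
rewrite gq aE hsubmxK -gp; apply: eq_pairing => k.
rewrite -[in RHS]mulmxA -trmx_mul CE (mxvec_pairing _ (u := t^T) (v := row_mx k 0)) ?trmxK //.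
by rewrite -{2}[t^T *m X]hsubmxK tr_row_mx mul_row_col trmx0 mulmx0 addr0.
Qed.

(** With [s *m t = 1], [X] is the sum of [s^T *m row_mx nu 0] and a remainder killed by [t^T] and
    [v^T]. The first is the gradient of an equation of [Y] pulled back along
    [H |-> lsubmx (s *m H)], the second that of a combination of 2x2 minors. *)
Lemma segre_conormal_sup (t : 'cV[K]_m) (v : 'rV[K]_(w + r)) (X : 'M[K]_(m, w + r)) nu :
  t != 0 -> v != 0 -> Y (lsubmx v) -> X *m v^T = 0 ->
  tangent_hyp Y (lsubmx v) nu -> t^T *m X = row_mx nu 0 ->
  tangent_hyp S (mxvec (t *m v)) (mxvec X).
Proof.
move=> t0 v0 Yv Xv tnu tX.
have [s ts] : exists s : 'rV[K]_m, s *m t = 1%:M.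
  have [|s ts] := @row_dual _ t^T; first by rewrite trmx_eq0.
  by exists s; apply: trmx_inj; rewrite trmx_mul ts trmx1.
have [e ve] := row_dual v0.
have nuy := conormal_orth Y_cone Yv tnu; case: tnu => q [qY nuE].
pose C := lin_mul_row s *m col_mx 1%:M 0 : 'M[K]_(m * (w + r), w).
have CE H : mxvec H *m C = lsubmx (s *m H).
  by rewrite mulmxA mul_vec_lin_row -{1}[s *m H]hsubmxK mul_row_col mulmx1 mulmx0 addr0.
have [Q QE gQ] := affine_pullback q 0 C.
have gQX : grad Q (mxvec (t *m v)) = mxvec (s^T *m row_mx nu 0).
  apply: eq_pairing => k; rewrite gQ add0r CE mulmxA ts mul1mx -nuE -[k]vec_mxK.
  rewrite mxvec_dotmul -[nu *m _ *m _]mulmxA -trmx_mul CE tr_row_mx -{2}[s *m _]hsubmxK mul_row_col.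
  by rewrite trmx0 mulmx0 addr0 -[lsubmx _ *m _]trmx11 trmx_mul trmxK.
pose X' := X - s^T *m row_mx nu 0.
have tX' : t^T *m X' = 0.
  by rewrite mulmxBr mulmxA -trmx_mul ts trmx1 mul1mx tX subrr.
have X'v : X' *m v^T = 0.
  rewrite mulmxBl Xv sub0r -mulmxA -[v]hsubmxK tr_row_mx mul_row_col mul0mx addr0.
  by rewrite nuy mulmx0 oppr0.
pose bil (a : 'rV[K]_m) (b : 'rV[K]_(w + r)) := linform (mxvec (a^T *m b)).
have ev_bil a b x : ev (bil a b) x = (a *m vec_mx x *m b^T) 0 0.
  by rewrite ev_linform -{1}[x]vec_mxK (mxvec_pairing _ erefl).
(* On rank one matrices M the polynomial (s M e)<X', M> - s M X'^T M e vanishes,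
   and its gradient at t v is X' because X' is orthogonal to t and to v. *)
pose P := bil s e * linform (mxvec X') - \sum_i bil s (row i X') * bil (delta_mx 0 i) e.
have X'row i : row i X' *m v^T = 0 by rewrite -row_mul X'v row0.
exists (P + Q); split=> [x [t' [v' [Yv' xE]]]|]; last first.
  rewrite gradD gQX gradB gradM !grad_linform ev_linform ev_bil mxvecK.
  rewrite mulmxA ts mul1mx ve -[t in mxvec (t *m v) *m _]trmxK
    mxvec_dotmul tX' mul0mx.
  rewrite mxE scale0r add0r mxE eqxx scale1r grad_sum.
  (* In each product the factor built on [row i X'] vanishes at the point, since [X' *m v^T = 0];
     the surviving terms add up to [s^T *m (t^T *m X')]. *)
  have -> : \sum_i grad (bil s (row i X') * bil (delta_mx 0 i) e) (mxvec (t *m v)) = 0.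
    transitivity (mxvec (s^T *m (t^T *m X'))); last by rewrite tX' mulmx0 linear0.
    rewrite mulmx_sum_row !linear_sum; apply: eq_bigr => i _ /=.
    rewrite gradM !grad_linform !ev_bil mxvecK !mulmxA ts mul1mx.
    rewrite -[v *m (row i X')^T]trmx11 trmx_mul trmxK X'row.
    rewrite [X in _ + X *: _]mxE scale0r addr0 -!mulmxA ve mulmx1 -rowE !mxE.
    by rewrite -scalemxAr linearZ.
  by rewrite subr0 -linearD subrK.
rewrite evD QE add0r -[x]vec_mxK CE xE mulmxA.
have mul11 (a b : 'M[K]_1) : (a *m b) 0 0 = a 0 0 * b 0 0 by rewrite mxE big_ord1.
rewrite [s *m t']mx11_scalar mul_scalar_mx linearZ /= qY; last exact: Y_cone.
rewrite addr0 /P evB evM ev_linform ev_bil ev_sum mxvecK.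
rewrite -[t' in mxvec (t' *m v') *m _]trmxK mxvec_dotmul mulmxA -mulmxA mul11.
rewrite -[t'^T *m X' *m _]mulmxA [X in _ * X - _]mxE mulr_sumr; apply/eqP.
rewrite subr_eq0; apply/eqP; apply: eq_bigr => i _.
rewrite evM !ev_bil mxvecK !mulmxA -!(mulmxA _ v') !mul11 -rowE
  [row i t' 0 0]mxE [t'^T 0 i]mxE.
rewrite -[v' *m (row i X')^T]trmx11 trmx_mul trmxK -row_mul [row i _ 0 0]mxE.
by rewrite mulrACA [RHS]mulrACA; congr (_ * _); rewrite mulrC.
Qed.

(** For nonzero [t] and [v] this is the conormal space at [t *m v] of the full Segre variety of rank
    one matrices. *)
Definition biorth (t : 'cV[K]_m) (v : 'rV[K]_(w + r)) : 'M[K]_(m * (w + r)) :=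
  (kermx (lin_mul_row t^T) :&: kermx (lin1_mx (mulmx v \o trmx \o vec_mx)))%MS.

Lemma biorthP t v u :
  reflect (t^T *m vec_mx u = 0 /\ vec_mx u *m v^T = 0) (u <= biorth t v)%MS.
Proof.
rewrite sub_capmx; apply: (iffP andP) => -[].
  move=> /sub_kermxP; rewrite -[u]vec_mxK mul_vec_lin_row => t0 /sub_kermxP.
  rewrite mul_rV_lin1 /= -[v in v *m _]trmxK -trmx_mul mxvecK => /(canRL trmxK) ->.
  by rewrite trmx0.
move=> tu uv; split; apply/sub_kermxP; first by rewrite -[u]vec_mxK mul_vec_lin_row.
by rewrite mul_rV_lin1 /= -[v in v *m _]trmxK -trmx_mul uv trmx0.
Qed.

(** The change of bases [X |-> P *m X *m Q^T] maps the space at [t, v] injectively into the one at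
    [t', v']. *)
Lemma rank_biorth_le t v t' v' : t != 0 -> v != 0 -> t' != 0 -> v' != 0 ->
  (\rank (biorth t v) <= \rank (biorth t' v'))%N.
Proof.
move=> t0 v0 t'0 v'0.
rewrite -trmx_eq0 in t0; rewrite -trmx_eq0 in t'0.
have [P Pu tP] := unitmx_transport t'0 t0.
have [Q Qu vQ] := unitmx_transport v'0 v0.
pose L := lin_mulmx P *m lin_mulmxr Q^T : 'M[K]_(m * (w + r)).
have LE X : X *m L = mxvec (P *m vec_mx X *m Q^T).
  by rewrite mulmxA mul_rV_lin /= mul_rV_lin /= mxvecK.
have Lf : row_free L.
  apply: inj_row_free => X; rewrite LE => /(congr1 vec_mx); rewrite mxvecK linear0.
  move=> /(congr1 (mulmx (invmx P))); rewrite -mulmxA mulKmx // mulmx0.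
  move=> /(congr1 (mulmx^~ (invmx Q^T))); rewrite mulmxK ?unitmx_tr // mul0mx.
  by move=> X0; rewrite -[X]vec_mxK X0 linear0.
rewrite -(mxrankMfree (biorth t v) Lf); apply/mxrankS/row_subP => i.
rewrite row_mul LE; have /biorthP [tX Xv] := row_sub i (biorth t v).
apply/biorthP; rewrite mxvecK -!mulmxA -trmx_mul vQ Xv mulmx0; split=> //.
by rewrite !mulmxA tP tX mul0mx.
Qed.

Lemma rank_biorth t v t' v' : t != 0 -> v != 0 -> t' != 0 -> v' != 0 ->
  \rank (biorth t v) = \rank (biorth t' v').
Proof. by move=> *; apply/eqP; rewrite eqn_leq !rank_biorth_le. Qed.

(** Rank-nullity for [X |-> t^T *m X] on the conormal space: the image is the conormal space of [Y]
    padded with zeros, the kernel is [biorth t v]. *)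
Lemma rank_segre_conormal (t : 'cV[K]_m) (v : 'rV[K]_(w + r))
    (G : 'M[K]_(m * (w + r))) (H : 'M[K]_w) :
  t != 0 -> v != 0 -> Y (lsubmx v) ->
  (forall h, tangent_hyp S (mxvec (t *m v)) h <-> (h <= G)%MS) ->
  (forall h, tangent_hyp Y (lsubmx v) h <-> (h <= H)%MS) ->
  \rank G = (\rank H + \rank (biorth t v))%N.
Proof.
move=> t0 v0 Yv GE HE.
have [|s ts] := @row_dual _ t^T; first by rewrite trmx_eq0.
pose I := row_mx 1%:M 0 : 'M[K]_(w, w + r).
have IE a (B : 'M[K]_(a, w)) : B *m I = row_mx B 0 by rewrite mul_mx_row mulmx1 mulmx0.
have If : row_free I.
  by apply/row_freeP; exists (col_mx 1%:M 0); rewrite mul_row_col mulmx1 mulmx0 addr0.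
rewrite -(mxrank_mul_ker G (lin_mul_row t^T)) -(mxrankMfree H If); congr (_ + _)%N.
  apply/eqmx_rank/andP; split; apply/row_subP => i; rewrite row_mul.
    have /GE := row_sub i G; rewrite -[row i G]vec_mxK => /(segre_conormal_sub Yv) [_].
    by case=> nu /HE nuH; rewrite mul_vec_lin_row => ->; rewrite -IE submxMr.
  have /HE nuH := row_sub i H; set nu := row i H in nuH *.
  have tX : t^T *m (s^T *m row_mx nu 0) = row_mx nu (0 : 'rV_r) by rewrite mulmxA ts mul1mx.
  rewrite IE -tX -mul_vec_lin_row submxMr //; apply/GE.
  apply: (segre_conormal_sup t0 v0 Yv _ nuH tX); rewrite -mulmxA -[v]hsubmxK tr_row_mx.
  by rewrite mul_row_col mul0mx addr0 (conormal_orth Y_cone Yv nuH) mulmx0.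
apply/eqmx_rank/rV_eqP => u; apply/idP/biorthP.
  rewrite sub_capmx => /andP [/GE]; rewrite -[u]vec_mxK => /(segre_conormal_sub Yv) [uv _].
  by move/sub_kermxP; rewrite mul_vec_lin_row mxvecK.
move=> [tu uv]; rewrite sub_capmx; apply/andP; split.
  apply/GE; rewrite -[u]vec_mxK; apply: (segre_conormal_sup (nu := 0)) => //.
    by apply/HE; rewrite sub0mx.
  by rewrite tu row_mx0.
by apply/sub_kermxP; rewrite -[u]vec_mxK mul_vec_lin_row.
Qed.

Hypothesis Y_nondeg : nondegenerate_var Y.

Lemma cone_over_nondeg y0 : Y y0 -> nondegenerate_var (cone_over r Y).
Proof.
move=> Y0 h hY; have hYE y u : Y y -> row_mx y u *m h^T = 0.
  by move=> Yy; apply: hY; rewrite /cone_over row_mxKl.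
rewrite -[h]hsubmxK -row_mx0; congr row_mx.
  apply: Y_nondeg => y /(hYE y 0).
  by rewrite -[h]hsubmxK tr_row_mx mul_row_col mul0mx addr0 row_mxKl.
apply: eq_pairing => k; have Y00 : Y 0 by rewrite -(scale0r y0); apply: Y_cone.
have := hYE 0 k Y00; rewrite -{1}[h]hsubmxK tr_row_mx mul_row_col mul0mx add0r => kh.
by rewrite mul0mx -[_ *m _]trmx11 trmx_mul trmxK kh.
Qed.

(** Conormal ranks at nonzero points exceed those on [Y] by a constant, so extremality transfers. At
    the vertex [x = 0] non-degeneracy makes the conormal space zero. *)
Lemma segre_smooth (t : 'cV[K]_m) (v : 'rV[K]_(w + r)) :
  t != 0 -> v != 0 -> smooth_pt Y (lsubmx v) -> smooth_pt S (mxvec (t *m v)).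
Proof.
move=> t0 v0 [Yv [_ Ymax]]; split; first exact: segre_mxvec.
have mul0 (a : 'cV[K]_m) (b : 'rV[K]_(w + r)) : b != 0 -> a *m b = 0 -> a = 0.
  by move=> /row_dual [e be] /(congr1 (mulmx^~ e^T)); rewrite -mulmxA be mulmx1 mul0mx.
split=> [|x k [t' [v' [Yv' xE]]]].
  rewrite -[0](linear0 mxvec) (inj_eq (can_inj mxvecK)).
  by apply: contra t0 => /eqP /(mul0 _ _ v0) ->.
have [G GE] := conormal_mx S (mxvec (t *m v)).
have [G' G'E] := conormal_mx S x.
rewrite (jac_rank_geE _ GE) (jac_rank_geE _ G'E) => /leq_trans; apply.
have [x0|x0] := eqVneq x 0.
  suff -> : G' = 0 by rewrite mxrank0.
  apply/row_matrixP => i; rewrite row0 -[row i G']vec_mxK.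
  have /G'E := row_sub i G'; rewrite x0 => /(conormal0 segre_cone) Sh.
  rewrite -[0](linear0 mxvec); congr mxvec; apply/row_matrixP => j; rewrite row0.
  apply: (cone_over_nondeg Yv) => v'' Yv''.
  have := Sh _ (segre_mxvec (delta_mx j 0) Yv'').
  rewrite -{1}[row i G']vec_mxK -[delta_mx j 0]trmxK trmx_delta mxvec_dotmul -rowE.
  by rewrite -[row j _ *m _]trmx11 trmx_mul trmxK.
have t'0 : t' != 0.
  by apply: contraNneq x0 => t'0; rewrite -[x]vec_mxK xE t'0 mul0mx linear0.
have v'0 : v' != 0.
  by apply: contraNneq x0 => v'0; rewrite -[x]vec_mxK xE v'0 mulmx0 linear0.
have [H HE] := conormal_mx Y (lsubmx v).
have [H' H'E] := conormal_mx Y (lsubmx v').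
rewrite (rank_segre_conormal t0 v0 Yv GE HE).
have G'E' h : tangent_hyp S (mxvec (t' *m v')) h <-> (h <= G')%MS by rewrite -xE vec_mxK.
rewrite (rank_segre_conormal t'0 v'0 Yv' G'E' H'E).
rewrite (rank_biorth t'0 v'0 t0 v0) leq_add2r.
by apply/(jac_rank_geE _ HE)/(Ymax _ _ Yv')/(jac_rank_geE _ H'E).
Qed.

Lemma segre_smooth_factor (t : 'cV[K]_m) (v : 'rV[K]_(w + r)) : (0 < r)%N ->
  t != 0 -> v != 0 -> Y (lsubmx v) -> lsubmx v != 0 ->
  smooth_pt S (mxvec (t *m v)) -> smooth_pt Y (lsubmx v).
Proof.
move=> r0 t0 v0 Yv y0 [_ [_ Smax]]; split=> //; split=> // y k Yy.
(* The point [y] may be 0; ones in the [U]-coordinates, available since [0 < r], keep [v'] nonzero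
   so that the rank formula applies. *)
pose v' : 'rV[K]_(w + r) := row_mx y (const_mx 1).
have v'0 : v' != 0.
  rewrite -row_mx0; apply/eqP => /eq_row_mx [_ /rowP /(_ (Ordinal r0))] /eqP.
  by rewrite !mxE oner_eq0.
have yE : lsubmx v' = y by rewrite row_mxKl.
have Yv' : Y (lsubmx v') by rewrite yE.
have [G GE] := conormal_mx S (mxvec (t *m v)).
have [G' G'E] := conormal_mx S (mxvec (t *m v')).
have [H HE] := conormal_mx Y (lsubmx v).
have [H' H'E] := conormal_mx Y (lsubmx v').
rewrite -{1}yE (jac_rank_geE _ HE) (jac_rank_geE _ H'E) => /leq_trans; apply.
have := Smax _ _ (segre_mxvec t Yv') (iffRL (jac_rank_geE _ G'E) (leqnn _)).
rewrite (jac_rank_geE _ GE) (rank_segre_conormal t0 v0 Yv GE HE).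
rewrite (rank_segre_conormal t0 v'0 Yv' G'E H'E).
by rewrite (rank_biorth t0 v'0 t0 v0) leq_add2r.
Qed.

End Segre.

End Conormal.

(** * Maximal minors and the left kernel of an (r+1) x r matrix *)

Section Minors.
Variable K : closedFieldType.
Variable r : nat.
Implicit Type B : 'M[K]_(r.+1, r).

(** The signed maximal minors, obtained as cofactors along an added column; the zeros only complete
    the square matrix. *)
Definition minors B : 'rV[K]_r.+1 :=
  \row_i cofactor (row_mx (0 : 'cV[K]_r.+1) B : 'M_r.+1) i ord0.

Lemma det_row_mx (a : 'cV[K]_r.+1) B :
  \det (row_mx a B : 'M_r.+1) = (minors B *m a) 0 0.
Proof.
rewrite (expand_det_col _ ord0) mxE; apply: eq_bigr => i _.
rewrite mulrC [minors B 0 i]mxE; congr (_ * _); last first.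
  by rewrite -[a i 0](row_mxEl a B); congr (row_mx a B i _); apply: val_inj.
congr (_ * \det _); apply/matrixP => k l; rewrite !mxE.
by case: split_ordP => // j /(congr1 val); rewrite /= ord1.
Qed.

(** Pairing the minors with a column of [B] is a determinant with that column repeated. *)
Lemma minors_mul B : minors B *m B = 0.
Proof.
apply/rowP => k; rewrite [RHS]mxE.
have -> : (minors B *m B) 0 k = (minors B *m col k B) 0 0.
  by rewrite colE mulmxA -colE [RHS]mxE.
rewrite -det_row_mx -det_tr.
apply: (@determinant_alternate _ _ _ (lshift r ord0) (rshift 1 k)) => // i.
by rewrite !mxE -[split (lshift _ _)]/(split (unsplit (inl _)))
  -[split (rshift _ _)]/(split (unsplit (inr _))) !unsplitK mxE.
Qed.

Lemma minors_unit B : minors B != 0 ->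
  exists2 a : 'cV[K]_r.+1, minors B *m a = 1%:M & (row_mx a B : 'M_r.+1) \in unitmx.
Proof.
move=> /row_dual [e be]; exists e^T => //.
by rewrite unitmxE det_row_mx be mxE unitr1.
Qed.

Lemma mul_row_block k (v : 'M[K]_(k, r.+1)) (a : 'cV[K]_r.+1) B :
  v *m (row_mx a B : 'M_r.+1) = row_mx (v *m a) (v *m B).
Proof. exact: (mul_mx_row v a B). Qed.

(** Both sides agree on the columns of the invertible matrix [row_mx a B], with [l] read off from
    [t *m a]. *)
Lemma minors_ker B (t : 'rV[K]_r.+1) : minors B != 0 -> t *m B = 0 ->
  exists l, t = l *: minors B.
Proof.
move=> /minors_unit [a ca aB] tB; exists ((t *m a) 0 0); apply/eqP; rewrite -subr_eq0.
suff /(congr1 (mulmx^~ (invmx (row_mx a B : 'M_r.+1)))) :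
    (t - (t *m a) 0 0 *: minors B) *m (row_mx a B : 'M_r.+1) = 0.
  by rewrite mulmxK // mul0mx => ->.
rewrite mul_row_block mulmxBl -scalemxAl ca scalemx1 -mx11_scalar subrr.
by rewrite mulmxBl -scalemxAl tB minors_mul scaler0 subr0 row_mx0.
Qed.

(** In the basis formed by [a] and the columns of [B], pairing with the minors extracts the
    coordinate of [x] along [a]. *)
Lemma minors_im B (x : 'cV[K]_r.+1) : minors B != 0 -> minors B *m x = 0 ->
  exists u : 'cV[K]_r, x = B *m u.
Proof.
move=> /minors_unit [a ca aB] cx.
pose z := invmx (row_mx a B : 'M_r.+1) *m x : 'cV[K]_(1 + r).
have xE : x = a *m usubmx z + B *m dsubmx z.
  by rewrite -mul_row_col vsubmxK mulKVmx.
exists (dsubmx z); move: cx; rewrite {1}xE mulmxDr !mulmxA ca minors_mul mul1mx mul0mx addr0.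
by move=> z0; rewrite {1}xE z0 mulmx0 add0r.
Qed.

Lemma row_completion (t : 'rV[K]_r.+1) : t != 0 ->
  exists a B, [/\ t *m a = 1%:M, t *m B = 0 & \det (row_mx a B : 'M_r.+1) != 0].
Proof.
move=> t0; have [|P Pu tP] := unitmx_transport t0 (v := row_mx 1%:M 0 : 'rV[K]_(1 + r)).
  rewrite -row_mx0; apply/eqP => /eq_row_mx [/matrixP/(_ 0 0)/eqP].
  by rewrite !mxE oner_eq0.
exists (lsubmx (P : 'M_(r.+1, 1 + r))), (rsubmx (P : 'M_(r.+1, 1 + r))).
rewrite hsubmxK -unitfE -unitmxE; split=> //.
  by rewrite mulmx_lsub tP row_mxKl.
by rewrite mulmx_rsub tP row_mxKr.
Qed.

(** The left kernel is nonzero by dimension. Were it a line spanned by [t], a column not orthogonal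
    to [t] would complete [B] to an invertible matrix, whose determinant is a combination of the
    minors. *)
Lemma rank_kermx_minors0 B : minors B = 0 -> (1 < \rank (kermx B))%N.
Proof.
move=> B0; rewrite ltnNge; apply/negP => rk.
have rk1 : \rank (kermx B) = 1%N.
  by apply/eqP; rewrite eqn_leq rk mxrank_ker subn_gt0 ltnS rank_leq_col.
have /rowV0Pn [t tB t0] : kermx B != 0 by rewrite -mxrank_eq0 rk1.
have [e te] := row_dual t0.
suff : (row_mx e^T B : 'M_r.+1) \in unitmx.
  by rewrite unitmxE det_row_mx B0 mul0mx mxE unitr0.
rewrite -row_free_unit; apply: inj_row_free => v v0.
have [ve vB] : v *m e^T = 0 /\ v *m B = 0.
  by apply: eq_row_mx; rewrite -mul_row_block v0 row_mx0.
have /sub_rVP [a va] : (v <= t)%MS.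
  apply: submx_trans (_ : v <= kermx B)%MS _; first exact/sub_kermxP.
  by rewrite -(geq_leqif (mxrank_leqif_sup tB)) rk1 rank_rV t0.
move: ve; rewrite va -scalemxAl te scalemx1 => /matrixP/(_ 0 0).
by rewrite !mxE mulr1n => ->; rewrite scale0r.
Qed.

End Minors.

(** * Zeros of a form on a pencil, and vanishing of hessians *)

Section PolarHessian.
Variable K : closedFieldType.

(** Unless [g] vanishes at [z2], its restriction to [z1 + s *: z2] is not constant and has a root: a
    constant value [c] would by homogeneity give [ev g (z2 + s *: z1) = c * s ^+ d], which is 0 at
    [s = 0]. *)
Lemma homog_root_pencil n d (g : {mpoly K[n]}) (z1 z2 : 'rV[K]_n) :
  (0 < d)%N -> g \is d.-homog ->
  exists a b, (a, b) != (0, 0) /\ ev g (a *: z1 + b *: z2) = 0.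
Proof.
move=> d0 gd; case: (eqVneq (ev g z2) 0) => [g2|g2].
  by exists 0, 1; rewrite scale0r add0r scale1r xpair_eqE oner_eq0 andbF.
have [phi phiE _] := ev_on_line g z1 z2; have [psi psiE _] := ev_on_line g z2 z1.
suff /closed_rootP [s /rootP phis] : size phi != 1%N.
  by exists 1, s; rewrite xpair_eqE oner_eq0 scale1r -phiE.
apply/eqP => /eqP /size_poly1P [c _ phic].
suff : psi - c *: 'X^d = 0.
  move=> /(congr1 (horner^~ 0)); rewrite !hornerE psiE scale0r addr0 expr0n.
  by rewrite (gtn_eqF d0) mulr0 subr0 => /eqP; rewrite (negPf g2).
suff /eqP : 'X * (psi - c *: 'X^d) = 0 by rewrite mulf_eq0 polyX_eq0 => /eqP.
apply: poly_eq0_of_roots => s; rewrite !hornerE psiE.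
have [->|s0] := eqVneq s 0; first by rewrite mul0r.
have -> : z2 + s *: z1 = s *: (z1 + s^-1 *: z2).
  by rewrite scalerDr scalerA divff // scale1r addrC.
by rewrite (ev_homogZ _ _ gd) -phiE phic hornerC mulrC [c * _]mulrC subrr mul0r.
Qed.

Lemma det0_of_kernel (R : idomainType) n (M : 'M[R]_n) (v : 'rV_n) :
  v != 0 -> v *m M = 0 -> \det M = 0.
Proof.
move=> v0 /(congr1 (mulmx^~ (\adj M))); rewrite -mulmxA mul_mx_adj mul0mx mul_mx_scalar.
move=> /rowP M0; have /rV0Pn [i vi] := v0.
by have /eqP := M0 i; rewrite !mxE mulf_eq0 (negPf vi) orbF => /eqP.
Qed.

(* Differentiating the relation puts the gradient of the quadric, evaluated at
   grad f, in the kernel of the Hessian matrix. *)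
Lemma hessian0_of_quadric n (f : {mpoly K[n]}) a b c d :
  b \notin [:: a; c; d] ->
  mderiv a f * mderiv b f = mderiv c f * mderiv d f -> hessian_poly f = 0.
Proof.
rewrite !inE !negb_or => /and3P [ba bc bd] quad; rewrite /hessian_poly.
set H := \matrix_(i, j) _.
have dH i : delta_mx 0 i *m H = \row_j mderiv j (mderiv i f).
  by rewrite -rowE; apply/rowP => j; rewrite !mxE.
have [fa0|fa0] := eqVneq (mderiv a f) 0.
  apply: (det0_of_kernel (v := delta_mx 0 a)).
    by apply/rV0Pn; exists a; rewrite mxE !eqxx oner_eq0.
  by rewrite dH; apply/rowP => j; rewrite !mxE fa0 linear0.
(* As [b] differs from the other three indices, the entry of [v] at [b] is [mderiv a f], so [v] is
   nonzero. *)
pose v := mderiv b f *: delta_mx 0 a + mderiv a f *: delta_mx 0 b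
  - mderiv d f *: delta_mx 0 c - mderiv c f *: delta_mx 0 d : 'rV_n.
apply: (det0_of_kernel (v := v)).
  apply/rV0Pn; exists b; rewrite !mxE eqxx (negPf ba) (negPf bc) (negPf bd) eqxx.
  by rewrite !mulr0 mulr1 add0r !subr0.
rewrite !mulmxBl mulmxDl -!scalemxAl !dH; apply/rowP => j; rewrite !mxE.
have /eqP := congr1 (mderiv j) quad; rewrite !mderivM -subr_eq0 => /eqP <-.
by rewrite opprD addrA [mderiv b f * _]mulrC [mderiv d f * _]mulrC.
Qed.

End PolarHessian.

(** * The polynomial f, its gradient and its hessian *)

Section DualSegre.
Variables (K : closedFieldType) (r w : nat).
Local Notation mat := 'M[K]_(r.+1, w + r).
Implicit Types (X : mat) (g : {mpoly K[w]}).

(** The vector of the determinants B'_j, by expansion along the first column. *)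
Definition bvec X : 'rV[K]_w := minors (rsubmx X) *m lsubmx X.

Lemma ev_fpoly g X : ev (fpoly r g) (mxvec X) = ev g (bvec X).
Proof.
rewrite /ev comp_mpoly_meval; apply: meval_eq => j.
rewrite tnth_mktuple -det_map_mx.
have -> : map_mx (meval (coords (mxvec X)))
    (\matrix_(a < r.+1, b < r.+1)
       match unlift ord0 b with
       | None => Xvar K a (lshift r j)
       | Some k => Xvar K a (rshift w k)
       end) = row_mx (col j (lsubmx X)) (rsubmx X) :> 'M_r.+1.
  apply/matrixP => a b; rewrite !mxE.
  case: split_ordP => k bE; case: unliftP => [l|] bE'.
  - by move/(congr1 val): bE; rewrite bE' /= ord1.
  - by rewrite mevalXU /coords mxvecE !mxE.
  - rewrite mevalXU /coords mxvecE !mxE; congr (X _ (rshift _ _)).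
    by move/(congr1 val): bE; rewrite bE' => -[]; apply: val_inj.
  by move/(congr1 val): bE; rewrite bE'.
by rewrite det_row_mx colE mulmxA -colE [LHS]mxE.
Qed.


(** Adding [s *: h] to row [i] of A' with B' fixed moves [bvec X] by [s] times the multiple of [h]
    by the [i]-th minor of B'. *)
Lemma grad_fpoly g X :
  lsubmx (vec_mx (grad (fpoly r g) (mxvec X)) : mat) =
  (minors (rsubmx X))^T *m grad g (bvec X).
Proof.
apply/row_matrixP => i; apply: eq_pairing => h.
set G := vec_mx _; set c := minors _.
have -> : row i (lsubmx G) *m h^T = grad (fpoly r g) (mxvec X) *m
    (mxvec ((delta_mx 0 i)^T *m row_mx h 0))^T.
  rewrite -[grad _ _]vec_mxK (mxvec_pairing _ erefl) -/G -rowE.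
  rewrite -[in RHS](hsubmxK G) tr_row_mx -[row i (row_mx _ _)]hsubmxK mul_row_col.
  by rewrite trmx0 mulmx0 addr0 row_row_mx row_mxKl.
have [phi phiE phi'E] := ev_on_line g (bvec X) (c 0 i *: h).
rewrite -(@grad_on_line _ _ _ _ _ phi) => [|s].
  rewrite phi'E row_mul linearZ /= -scalemxAr.
  have -> : row i c^T = (c 0 i)%:M by rewrite [LHS]mx11_scalar !mxE.
  by rewrite mul_scalar_mx -scalemxAl.
rewrite -linearZ -linearD /= ev_fpoly phiE; congr (ev g _).
rewrite mul_mx_row mulmx0 scale_row_mx scaler0 -{1}(hsubmxK X) add_row_mx addr0.
rewrite /bvec row_mxKl row_mxKr mulmxDr -scalemxAr mulmxA trmx_delta -colE -/c.
by rewrite [col i c]mx11_scalar mul_scalar_mx mxE.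
Qed.

(** A gradient is the sum of its [U]-columns, a point of the vertex, and its [W]-columns, a rank one
    matrix whose row factor is a value of the polar map of [g]. *)
Lemma polar_image_fpoly g :
  set_incl (polar_image (fpoly r g)) (join_var (PTU r.+1 w r) (segreW r.+1 r (polar_image g))).
Proof.
move=> z zP p pP; apply: zP => _ [x ->]; apply: pP.
rewrite -[x]vec_mxK; set X := vec_mx x.
set G := vec_mx (grad (fpoly r g) (mxvec X)).
exists (mxvec (row_mx 0 (rsubmx G))), (mxvec (row_mx (lsubmx G) 0)); split; [|split].
- by rewrite /PTU /mxset mxvecK row_mxKl.
- rewrite /segreW /segre /mxset mxvecK grad_fpoly.
  exists (minors (rsubmx X))^T, (row_mx (grad g (bvec X)) 0).
  rewrite row_mxKl row_mxKr mul_mx_row mulmx0; split=> //; split=> // q; apply.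
  by exists (bvec X).
by rewrite -linearD add_row_mx add0r addr0 hsubmxK /G [RHS]vec_mxK.
Qed.

Lemma mxvec_index_eq m n (i i' : 'I_m) (j j' : 'I_n) :
  (mxvec_index i j == mxvec_index i' j') = ((i, j) == (i', j')).
Proof. by rewrite /mxvec_index (inj_eq (@cast_ord_inj _ _ _)) (inj_eq enum_rank_inj). Qed.

(** The [W]-block of the gradient has rank one at every point and at least two rows and columns; a
    vanishing 2x2 minor gives the quadratic relation, an identity of polynomials in characteristic
    zero. *)
Lemma hessian_fpoly g : [pchar K] =i pred0 -> (0 < r)%N -> (1 < w)%N ->
  hessian_poly (fpoly r g) = 0.
Proof.
move=> K0 r0 w1; pose w0 := ltnW w1.
pose i0 : 'I_r.+1 := ord0; pose i1 : 'I_r.+1 := Ordinal (r0 : 1 < r.+1)%N.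
pose j0 := lshift r (Ordinal w0); pose j1 := lshift r (Ordinal w1).
apply: (@hessian0_of_quadric _ _ _ (mxvec_index i0 j0) (mxvec_index i1 j1)
  (mxvec_index i0 j1) (mxvec_index i1 j0)).
  by rewrite !inE !mxvec_index_eq.
apply/eqP; rewrite -subr_eq0; apply/eqP/(mpoly_eq0_of_ev K0) => x.
have dE i j : ev (mderiv (mxvec_index i (lshift r j)) (fpoly r g)) x =
    minors (rsubmx (vec_mx x : mat)) 0 i * grad g (bvec (vec_mx x)) 0 j.
  transitivity (lsubmx (vec_mx (grad (fpoly r g) (mxvec (vec_mx x : mat))) : mat) i j).
    by rewrite vec_mxK !mxE.
  by rewrite grad_fpoly mxE big_ord1 mxE.
by rewrite evB !evM !dE mulrACA [X in _ - X]mulrACA [X in _ - _ * X]mulrC subrr.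
Qed.

End DualSegre.

(** * The equation of the dual variety of the Segre product *)

Section DualEquation.
Variables (K : closedFieldType) (r w d : nat) (Y : 'rV[K]_w -> Prop) (g : {mpoly K[w]}).
Hypothesis Y_cone : forall a y, Y y -> Y (a *: y).
Hypothesis Y_nondeg : nondegenerate_var Y.
Hypotheses (r_gt0 : (0 < r)%N) (d_gt0 : (0 < d)%N) (g_homog : g \is d.-homog).
Hypothesis Y_dual : forall z, dual_variety Y z <-> zero_set g z.
Local Notation mat := 'M[K]_(r.+1, w + r).
Local Notation S := (segre r.+1 (cone_over r Y)).
Implicit Type X : mat.

Lemma ev_homog0 : ev g 0 = 0.
Proof.
by rewrite -(scale0r (0 : 'rV[K]_w)) (ev_homogZ _ _ g_homog) expr0n gtn_eqF // mul0r.
Qed.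

(** If the minors of B' are not all zero, [t] is a nonzero multiple of them and homogeneity removes
    the scalar; otherwise [bvec X = 0], a zero of [g] because [0 < d]. *)
Lemma bvec_left_kernel X (t : 'rV[K]_r.+1) : t != 0 -> t *m rsubmx X = 0 ->
  ev g (t *m lsubmx X) = 0 -> ev g (bvec X) = 0.
Proof.
move=> t0 tX gt; have [c0|c0] := eqVneq (minors (rsubmx X)) 0.
  by rewrite /bvec c0 mul0mx ev_homog0.
have [l tE] := minors_ker c0 tX; move: gt t0.
rewrite tE -scalemxAl (ev_homogZ _ _ g_homog) scaler_eq0 negb_or => /eqP.
by rewrite mulf_eq0 expf_eq0 => /orP [/andP [_ ->]|/eqP].
Qed.

(** The zero set is closed, so tangent hyperplanes at smooth points [t *m v] suffice. There [t^T]
    kills B' and sends A' to a conormal vector [nu] of [Y], which is 0 or a point of the dual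
    variety. *)
Lemma dual_segre_sub x : dual_variety S x -> zero_set (fpoly r g) x.
Proof.
apply=> h [_ [xs [smooth tangent]]]; rewrite -[h]vec_mxK ev_fpoly.
have [[t [v [Yv xsE]]] [xs0 _]] := smooth.
rewrite -[xs]vec_mxK xsE in xs0 smooth tangent.
have t0 : t != 0 by apply: contraNneq xs0 => ->; rewrite mul0mx linear0.
have v0 : v != 0 by apply: contraNneq xs0 => ->; rewrite mulmx0 linear0.
rewrite -[h]vec_mxK in tangent.
have [_ [nu nuY tX]] := segre_conormal_sub Yv tangent.
apply: (bvec_left_kernel (t := t^T)); rewrite ?trmx_eq0 //.
  by rewrite mulmx_rsub tX row_mxKr.
rewrite mulmx_lsub tX row_mxKl; have [->|nu0] := eqVneq nu 0; first exact: ev_homog0.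
apply/Y_dual => p; apply; split=> //; exists (lsubmx v); split=> //.
(* A nonzero [nu] excludes [lsubmx v = 0], since a non-degenerate cone has no nonzero conormal
   vector at its vertex. *)
apply: (segre_smooth_factor _ _ t0 v0) => //; apply: contraNneq nu0 => y0.
by apply/eqP/Y_nondeg/(conormal0 Y_cone); rewrite -y0.
Qed.

(** The tangency point is built from [X]: [t] is the vector of minors of B', and [v = (y, -u^T)]
    where [u] solves A' y^T = B' u, solvable because [bvec X] is orthogonal to [y]. *)
Lemma dual_segre_of_smooth X y : minors (rsubmx X) != 0 -> bvec X != 0 ->
  smooth_pt Y y -> tangent_hyp Y y (bvec X) ->
  exists x, smooth_pt S x /\ tangent_hyp S x (mxvec X).
Proof.
move=> c0 b0 ysm yt; have [Yy [y0 _]] := ysm.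
have [u uE] : exists u, lsubmx X *m y^T = rsubmx X *m u.
  by apply: minors_im => //; rewrite mulmxA (conormal_orth Y_cone Yy yt).
pose v := row_mx y (- u^T); have yE : lsubmx v = y by rewrite row_mxKl.
have v0 : v != 0 by apply: contraNneq y0 => v0; rewrite -yE v0 linear0.
have t0 : (minors (rsubmx X))^T != 0 by rewrite trmx_eq0.
rewrite -yE in ysm yt Yy.
exists (mxvec ((minors (rsubmx X))^T *m v)); split; first exact: segre_smooth.
apply: (segre_conormal_sup Y_cone t0 v0 Yy _ yt).
  rewrite -[X]hsubmxK tr_row_mx mul_row_col linearN /= trmxK mulmxN.
  by rewrite uE subrr.
by rewrite trmxK -{2}[X]hsubmxK mul_mx_row minors_mul.
Qed.

(** The pullback [q] of [p] along an affine section of [bvec] through [X] vanishes at the tangent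
    hyperplanes of [Y], hence on the zero set of [g], which contains [bvec X]. *)
Lemma minors_neq0_dual p X :
  ideal_of (fun h => h != 0 /\ exists x, smooth_pt S x /\ tangent_hyp S x h) p ->
  minors (rsubmx X) != 0 -> ev g (bvec X) = 0 -> ev p (mxvec X) = 0.
Proof.
move=> pD c0 gX; have [s cs] := row_dual c0.
(* Moving A' along s changes b = bvec X to an arbitrary vector z and fixes B'. *)
pose C := row_mx 1%:M 0 *m lin1_mx (mxvec \o mulmx s^T) : 'M[K]_(w, r.+1 * (w + r)).
have CE z : z *m C = mxvec (s^T *m row_mx z 0).
  by rewrite mulmxA mul_rV_lin1 /= mul_mx_row mulmx1 mulmx0.
have [q qE _] := affine_pullback p (mxvec X - bvec X *m C) C.
pose Xz z : mat := X + s^T *m row_mx (z - bvec X) 0.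
have XzE z : mxvec X - bvec X *m C + z *m C = mxvec (Xz z).
  by rewrite addrAC -addrA -mulmxBl CE -linearD.
have XzP z : rsubmx (Xz z) = rsubmx X /\ bvec (Xz z) = z.
  have rE : rsubmx (Xz z) = rsubmx X.
    by rewrite /Xz mul_mx_row mulmx0 -{1}[X]hsubmxK add_row_mx addr0 row_mxKr.
  split=> //; rewrite /bvec rE /Xz mul_mx_row mulmx0 -[X in lsubmx (X + _)]hsubmxK.
  by rewrite add_row_mx row_mxKl mulmxDr mulmxA cs mul1mx addrC subrK.
have /Y_dual /(_ q) : zero_set g (bvec X) by [].
rewrite qE subrK; apply=> z [z0 [y [ysm yt]]]; rewrite qE XzE.
have [rE bE] := XzP z; apply: pD; split.
  apply: contraNneq z0 => Xz0; rewrite -bE -(mxvecK (Xz z)) Xz0 linear0.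
  by rewrite /bvec [lsubmx 0]linear0 mulmx0.
by apply: (dual_segre_of_smooth (y := y)); rewrite ?rE ?bE.
Qed.

(* If B' drops rank, its left kernel contains a pencil, hence some t with
   g(t A') = 0; replacing B' by generic matrices on a line through it inside
   t^\perp stays on V(f) and reaches the maximal rank locus. *)
Lemma minors0_dual p X :
  ideal_of (fun h => h != 0 /\ exists x, smooth_pt S x /\ tangent_hyp S x h) p ->
  minors (rsubmx X) = 0 -> ev p (mxvec X) = 0.
Proof.
move=> pD /rank_kermx_minors0 rk; set B := rsubmx X.
pose Ker := row_base (kermx B); pose z i := row i Ker *m lsubmx X.
pose k0 := Ordinal (ltnW rk); pose k1 := Ordinal rk.
have [a [b [ab gab]]] := homog_root_pencil (z k0) (z k1) d_gt0 g_homog.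
pose t := a *: row k0 Ker + b *: row k1 Ker.
have tB : t *m B = 0.
  apply/sub_kermxP; rewrite -(eq_row_base (kermx B)).
  by rewrite addmx_sub ?scalemx_sub ?row_sub.
have t0 : t != 0.
  apply: contraNneq ab => /eqP; rewrite /t !rowE !scalemxAl -mulmxDl.
  rewrite mulmx_free_eq0 ?row_base_free // => /eqP /rowP e0.
  have := e0 k0; have := e0 k1; rewrite !mxE !eqxx.
  by rewrite !mulr1 !mulr0 addr0 add0r => -> ->.
have gt : ev g (t *m lsubmx X) = 0 by rewrite /t mulmxDl -!scalemxAl.
have [e [B1 [te tB1 detB1]]] := row_completion t0.
pose Xs s : mat := X + s *: row_mx 0 (B1 - B).
have rXs s : rsubmx (Xs s) = B + s *: (B1 - B).
  by rewrite linearD linearZ /= row_mxKr.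
have lXs s : lsubmx (Xs s) = lsubmx X.
  by rewrite linearD linearZ /= row_mxKl scaler0 addr0.
have [phi phiE _] := ev_on_line p (mxvec X) (mxvec (row_mx 0 (B1 - B))).
(* The determinant of [M], as a polynomial in [s], can be nonzero only where B' has nonzero minors;
   at [s = 1] it equals that of [row_mx e B1], which is not 0. *)
pose M : 'M[{poly K}]_r.+1 := map_mx polyC (row_mx e B : 'M_r.+1)
  + 'X *: map_mx polyC (row_mx (0 : 'cV[K]_r.+1) (B1 - B) : 'M_r.+1).
have ME s : (\det M).[s] = \det (row_mx e (rsubmx (Xs s)) : 'M_r.+1).
  rewrite -/(horner_eval s _) -det_map_mx; congr (\det _).
  transitivity (row_mx e B + s *: row_mx (0 : 'cV[K]_r.+1) (B1 - B)).
    by apply/matrixP => i j; rewrite /M !mxE /= /horner_eval !hornerE.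
  by rewrite scale_row_mx add_row_mx scaler0 addr0 rXs.
(* Since [\det M] is not the zero polynomial, [phi] must be; its value at 0 is the value of [p] at
   [X]. *)
suff /eqP : \det M * phi = 0.
  rewrite mulf_eq0 => /orP [/eqP M0|/eqP phi0].
    have := ME 1; rewrite rXs scale1r addrC subrK M0 horner0 => /esym /eqP.
    by rewrite (negPf detB1).
  by have := phiE 0; rewrite phi0 horner0 scale0r addr0.
apply: poly_eq0_of_roots => s; rewrite hornerM ME phiE.
rewrite (_ : _ + _ = mxvec (Xs s)); last by rewrite [RHS]linearD /= linearZ.
have [c0|c0] := eqVneq (minors (rsubmx (Xs s))) 0.
  by rewrite det_row_mx c0 mul0mx mxE mul0r.
rewrite (minors_neq0_dual pD c0) ?mulr0 //; apply: (bvec_left_kernel t0); last by rewrite lXs.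
by rewrite rXs mulmxDr -scalemxAr mulmxBr tB tB1 subrr scaler0 addr0.
Qed.

Lemma dual_segreE x : dual_variety S x <-> zero_set (fpoly r g) x.
Proof.
split=> [|fx p pD]; first exact: dual_segre_sub.
rewrite -[x]vec_mxK; have [c0|c0] := eqVneq (minors (rsubmx (vec_mx x : mat))) 0.
  exact: minors0_dual.
by apply: minors_neq0_dual => //; rewrite -ev_fpoly vec_mxK.
Qed.

End DualEquation.

Lemma proj_closed_cone (K : closedFieldType) n (C : 'rV[K]_n -> Prop) :
  proj_closed C -> forall a y, C y -> C (a *: y).
Proof.
move=> [T [Thom CE]] a y /CE Cy; apply/CE => p Tp.
by have [e pe] := Thom p Tp; rewrite (ev_homogZ _ _ pe) Cy // mulr0.
Qed.

Theorem theorem3p5 (K : closedFieldType) (r N d : nat)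
  (Y : 'rV[K]_((N - r).+1) -> Prop) (g : {mpoly K[(N - r).+1]}) :
  [pchar K] =i pred0 ->
  (1 <= r)%N -> (r < N)%N ->
  proj_variety Y -> nondegenerate_var Y ->
  (2 <= d)%N -> g \is d.-homog -> g != 0 ->
  (forall z, dual_variety Y z <-> zero_set g z) ->
  (* (i) *)
  (forall x, dual_variety (segre r.+1 (cone_over r Y)) x <->
             zero_set (fpoly r g) x) /\
  (* (ii) *)
  set_incl (polar_image (fpoly r g))
         (join_var (PTU r.+1 (N - r).+1 r) (segreW r.+1 r (polar_image g))) /\
  hessian_poly (fpoly r g) = 0.
Proof.
move=> K0 r0 rN [Yclosed _] Ynd d2 gd _ Ydual; split; [|split].
- by move=> x; apply: (dual_segreE (proj_closed_cone Yclosed) Ynd r0 (ltnW d2) gd Ydual).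
- exact: polar_image_fpoly.
(* The condition [r < N] supplies the two [W]-columns of the 2x2 minor. *)
- by apply: hessian_fpoly; rewrite // ltnS subn_gt0.
Qed.
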